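(* Let $\alpha\in[0,2)$, and let $\mathcal X\subseteq\mathcal H$ be a vector subspace of the Hilbert space $\mathcal H$ equipped with its own norm $\|\cdot\|_{\mathcal X}$. Then: 1. If there is a constant $A>0$ such that for all $f\in\mathcal X$ and all $\delta>0$ $$\sigma_{f-f^*}(-\delta,\delta]\le A\|f\|_{\mathcal X}^2\,\delta^\alpha,$$ then for all real $t>s$ $$\|P_{t,s}-P\|_{\mathcal X\to\mathcal H}^2\le B(t-s)^{-\alpha},\qquad\text{where one can take } B=\frac{2^{\alpha+1}}{2-\alpha}A.$$ 2. If for some constant $B>0$ the inequality $\|P_{t,s}-P\|_{\mathcal X\to\mathcal H}^2\le B(t-s)^{-\alpha}$ holds for all real $t>s$, then for all $f\in\mathcal X$ and all $\delta>0$ $$\sigma_{f-f^*}(-\delta,\delta]\le A\|f\|_{\mathcal X}^2\,\delta^\alpha,\qquad\text{where } A=\frac{\rho(\alpha)}{2^\alpha}B\ \left(\le\frac{\pi^{2-\alpha}}{4}B\right).$$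
   Context: $\mathcal H$ is a complex Hilbert space and $\{U^t\}_{t\in\mathbb R}$ is a strongly continuous group of unitary operators on $\mathcal H$. For $f\in\mathcal H$ and real $t>s$ put $P_{t,s}f=\frac1{t-s}\int_s^tU^\tau f\,d\tau$. $P$ is the orthogonal projection of $\mathcal H$ onto the subspace of vectors fixed by all $U^t$, and $f^*:=Pf$. By Stone's theorem $U^t=e^{it\mathbf B}$ with $\mathbf B$ self-adjoint; let $E$ be its spectral resolution, so that $(U^tf,g)_{\mathcal H}=\int_{\mathbb R}e^{it\lambda}\,d(E(\lambda)f,g)_{\mathcal H}$. For $h\in\mathcal H$, the spectral measure $\sigma_h$ is the finite Borel measure on $\mathbb R$ given by $\sigma_h(C)=\int_C d(E(\lambda)h,h)_{\mathcal H}$; $\sigma_h(-\delta,\delta]$ denotes $\sigma_h((-\delta,\delta])$. For an operator $T$ on $\mathcal H$, $\|T\|_{\mathcal X\to\mathcal H}=\sup_{f\in\mathcal X,\,f\ne0}\|Tf\|_{\mathcal H}/\|f\|_{\mathcal X}$. For $\alpha\in[0,2]$, $\rho(\alpha)=\inf_{x>0}\frac{x^{2-\alpha}}{\sin^2x}$. *)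

(* Defs.v *)
From HB Require Import structures.
From mathcomp Require Import all_boot all_order all_algebra.
From mathcomp Require Import all_classical all_reals all_analysis.
From mathcomp Require Import complex.

Set Implicit Arguments.
Unset Strict Implicit.
Unset Printing Implicit Defensive.

Import Order.TTheory GRing.Theory Num.Def Num.Theory.
Import numFieldNormedType.Exports.

Local Open Scope classical_set_scope.
Local Open Scope ring_scope.
Local Open Scope complex_scope.

(** Complex Hilbert spaces. The inner product is linear in its first argument.
    The library norm of a normed module over [R[i]] is [R[i]]-valued. *)
HB.mixin Record isHilbert (R : realType) H of CompleteNormedModule R[i] H := {
  ip : {dot H for (@Num.conj R[i])} ;
  norm_ip : forall f : H, `|f| ^+ 2 = ip f f }.

#[short(type="hilbertType")]
HB.structure Definition Hilbert (R : realType) :=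
  { H of isHilbert R H & CompleteNormedModule R[i] H }.

Section Operators.
Context {R : realType} {H : hilbertType R}.
Implicit Types (f g v : H) (U : R -> {linear H -> H}).

Definition hnorm f : R := complex.Re `|f|.

Definition unitary (T : H -> H) : Prop :=
  (forall f g, ip (T f) (T g) = ip f g) /\ (forall g, exists f, T f = g).

Record unitary_group U : Prop := UnitaryGroup {
  ug_unitary : forall t, unitary (U t) ;
  ug0 : forall f, U 0 f = f ;
  ugD : forall s t f, U (s + t) f = U s (U t f) ;
  ug_continuous : forall f, continuous (fun t : R => U t f) }.

Definition fixed_space U : set H := [set f | forall t, U t f = f].

Definition orthogonal_projection (V : set H) (P : H -> H) : Prop :=
  forall f, V (P f) /\ forall g, V g -> ip (f - P f) g = 0.

(** Riemann integral of [F : R -> H] over [`[a, b]], as a limit in norm of sums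
    over tagged partitions [a :: s] with tags [tag 0, tag 1, ...]. *)
Definition riemann_sum (F : R -> H) (a : R) (s : seq R) (tag : nat -> R) : H :=
  \sum_(i < size s) (nth a s i - nth a (a :: s) i)%:C *: F (tag i).

Definition is_riemann_integral (F : R -> H) (a b : R) v : Prop :=
  forall e : R, 0 < e -> exists2 d : R, 0 < d &
    forall (s : seq R) (tag : nat -> R), itv_partition a b s ->
      (forall i, (i < size s)%N ->
         nth a s i - nth a (a :: s) i < d /\
         nth a (a :: s) i <= tag i <= nth a s i) ->
      hnorm (riemann_sum F a s tag - v) < e.

(** Equal to [0] by convention if [F] is not integrable. *)
Definition riemann_integral (F : R -> H) (a b : R) : H :=
  xget 0 [set v | is_riemann_integral F a b v].

Definition time_average U (t s : R) f : H :=
  (t - s)^-1%:C *: riemann_integral (fun tau => U tau f) s t.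

End Operators.

(** Resolutions of the identity [E : R -> (H -> H)], with the convention that
    [E] is right continuous. *)
Record resolution (R : realType) (H : hilbertType R) := Resolution {
  res_proj :> R -> {linear H -> H} ;
  res_selfadjoint : forall l (f g : H),
    ip (res_proj l f) g = ip f (res_proj l g) ;
  res_mul : forall l m (f : H),
    res_proj l (res_proj m f) = res_proj (Num.min l m) f ;
  res_right_continuous : forall (f : H) (l : R),
    res_proj m f @[m --> l^'+] --> res_proj l f ;
  res_Ny : forall f : H, res_proj l f @[l --> -oo] --> (0 : H) ;
  res_y : forall f : H, res_proj l f @[l --> +oo] --> f }.

Section SpectralMeasure.
Context {R : realType} {H : hilbertType R} (E : resolution H).
Implicit Types f g h : H.

Definition spectral_cdf h : R -> R := fun l => complex.Re (ip (E l h) h).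

Lemma spectral_cdfE h l : spectral_cdf h l = hnorm (E l h) ^+ 2.
Proof.
rewrite /spectral_cdf /hnorm.
have -> : ip (E l h) h = `|E l h| ^+ 2.
  by rewrite norm_ip -res_selfadjoint res_mul minxx.
have /RRe_real {1}<- : `|E l h| \is Num.real by exact: normr_real.
by rewrite -(rmorphXn (real_complex R)).
Qed.

Lemma spectral_cdf_nd h : nondecreasing (spectral_cdf h).
Proof.
move=> l m lm; rewrite -subr_ge0 /spectral_cdf.
set d := E m h - E l h.
have dE : ip (E m h) h - ip (E l h) h = ip d d.
  have lin k k' : ip (E k h) (E k' h) = ip (E (Num.min k' k) h) h.
    by rewrite -res_selfadjoint res_mul.
  rewrite /d linearBl/= !linearBr/= !lin !minxx (min_l lm) (min_r lm).
  by rewrite subrr subr0.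
have : 0 <= ip d d by exact: dnorm_ge0.
by rewrite -dE lecE => /andP[_]; rewrite -(raddfB (@complex.Re R : Rcomplex R -> R)).
Qed.

Lemma spectral_cdf_rc h : right_continuous (spectral_cdf h).
Proof.
move=> l; rewrite (_ : spectral_cdf h = fun m => hnorm (E m h) ^+ 2); last first.
  by apply/funext => m; exact: spectral_cdfE.
have cn : hnorm (E m h) @[m --> l^'+] --> hnorm (E l h).
  apply/cvgrPdist_lt => e e0.
  have /cvgrPdist_lt/(_ e%:C) := @res_right_continuous _ _ E h l.
  rewrite ltcR => /(_ e0); apply: filterS => m.
  move=> /(le_lt_trans (ler_dist_dist _ _)).
  rewrite -ltcR; apply: le_lt_trans.
  rewrite /hnorm -(raddfB (@complex.Re R : Rcomplex R -> R)).
  exact: normc_ge_Re.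
exact: (cvgM cn cn).
Qed.

HB.instance Definition _ h := isCumulative.Build R _ R (spectral_cdf h)
  (@spectral_cdf_nd h) (@spectral_cdf_rc h).

Definition spectral_measure h : {measure set (measurableTypeR R) -> \bar R} :=
  lebesgue_stieltjes_measure (spectral_cdf h).

Definition spectral_integral_diag (phi : R -> R[i]) h : R[i] :=
  (\int[spectral_measure h]_l complex.Re (phi l)) +i*
  (\int[spectral_measure h]_l complex.Im (phi l)).

(** The integral of [phi] with respect to the complex measure [d(E(l)f, g)],
    which by polarization is the combination
    [1/4 \sum_(k < 4) i^k d(E(l)(f + i^k g), f + i^k g)]. *)
Definition spectral_integral (phi : R -> R[i]) f g : R[i] :=
  4^-1 * \sum_(k < 4)
    ('i ^+ k * spectral_integral_diag phi (f + 'i ^+ k *: g)).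

(** [E] is the spectral resolution of the generator of [U], i.e.
    [(U^t f, g) = \int e^{i t l} d(E(l)f, g)]. *)
Definition spectral_resolution (U : R -> {linear H -> H}) : Prop :=
  forall t f g,
    ip (U t f) g = spectral_integral (fun l => cos (t * l) +i* sin (t * l)) f g.

End SpectralMeasure.

Record normed_subspace (R : realType) (H : hilbertType R) := NormedSubspace {
  ns_carrier : set H ;
  ns_norm : H -> R ;
  ns0 : ns_carrier 0 ;
  nsD : forall f g, ns_carrier f -> ns_carrier g -> ns_carrier (f + g) ;
  nsZ : forall (a : R[i]) f, ns_carrier f -> ns_carrier (a *: f) ;
  ns_norm_ge0 : forall f, ns_carrier f -> 0 <= ns_norm f ;
  ns_norm_eq0 : forall f, ns_carrier f -> ns_norm f = 0 -> f = 0 ;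
  ns_normZ : forall (a : R[i]) f, ns_carrier f ->
    ns_norm (a *: f) = complex.Re `|a| * ns_norm f ;
  ns_normD : forall f g, ns_carrier f -> ns_carrier g ->
    ns_norm (f + g) <= ns_norm f + ns_norm g }.

(** The supremum is taken in [0, +oo]; it is [0] when [X] is the zero space. *)
Definition opnorm (R : realType) (H : hilbertType R) (X : normed_subspace H)
    (T : H -> H) : \bar R :=
  maxe 0%E (ereal_sup
    [set (hnorm (T f) / ns_norm X f)%:E | f in [set f | ns_carrier X f /\ f != 0]]).

(** The quotient is [+oo] at the zeros of [sin], which are excluded because
    division by zero returns [0]. *)
Definition rho (R : realType) (alpha : R) : R :=
  inf [set x `^ (2 - alpha) / sin x ^+ 2 | x in [set x | 0 < x /\ sin x != 0]].

(* Main.v *)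
Require Import Defs.
From HB Require Import structures.
From mathcomp Require Import all_boot all_order all_algebra.
From mathcomp Require Import all_classical all_reals all_analysis.
From mathcomp Require Import complex measurable_realfun ring lra.

Set Implicit Arguments.
Unset Strict Implicit.
Unset Printing Implicit Defensive.

Import Order.TTheory GRing.Theory Num.Def Num.Theory.
Import numFieldNormedType.Exports.

Local Open Scope classical_set_scope.
Local Open Scope ring_scope.

(** Write h = f - P f and T = t - s. The whole theorem rests on one identity,

      ||P_{t,s} f - P f||^2 = int (sin (T l / 2) / (T l / 2))^2 d sigma_h(l),

    the kernel being 1 at l = 0 ([time_averageE]). It turns both parts into
    statements about a finite measure sigma on the line: decay of the Fejer
    integral at rate T^-alpha on one side, smallness of the mass of
    ]-delta, delta] on the other.

    The identity is obtained through the isometry [hnorm_exp_sum]: for real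
    coefficients,

      ||sum_i c_i U^{tau_i} h||^2 = int |sum_i c_i e^{i tau_i l}|^2 d sigma_h(l),

    which follows from (U^t h, h) = int e^{i t l} d sigma_h(l) and unitarity.
    It applies to Riemann sums of the orbit of h and to differences of two of
    them. The scalar sums converge to int_s^t e^{i tau l} d tau, with an error at
    most |l| d (t - s) for mesh d, and they stay bounded by t - s; dominated
    convergence then makes the vector sums Cauchy, so that the vector Riemann
    integral exists by completeness, and carries the isometry to the limit
    ([riemann_integral_exists]). The invariant component P f contributes
    exactly (t - s) P f to every Riemann sum.

    From mass to rate ([fejer_integral_le]): the kernel is at most 1 and at most
    (2 / (T l))^2, so it exceeds u only on |l| < delta = (2 / T) u^(-1/2), whose
    mass is at most C delta^alpha. Integrating these masses over u in ]0, 1[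
    gives C (2 / T)^alpha int_0^1 u^(-alpha/2) du, and this last integral is
    1 / (1 - alpha / 2), whence the constant 2^(alpha + 1) / (2 - alpha).

    From rate to mass ([fejer_integral_ge]): for 0 < x < pi and T = 2 x / delta,
    the kernel is at least (sin x / x)^2 on [-delta, delta], because sin x / x
    decreases on ]0, pi[. The rate therefore bounds the mass by a multiple of
    x^(2 - alpha) / sin^2 x, and the infimum over all x > 0 is already the
    infimum over 0 < x < pi, since translating x by a multiple of pi towards 0
    keeps sin^2 x and decreases the numerator ([rho_ge]). *)

(** * Norms of linear combinations in a Hilbert space *)

Section HilbertNorm.
Context {R : realType} {H : hilbertType R}.
Implicit Types f g h : H.

Lemma ReD (x y : R[i]) : complex.Re (x + y) = complex.Re x + complex.Re y.
Proof. by case: x y => [? ?] [? ?]. Qed.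

Lemma Re_sum (I : finType) (F : I -> R[i]) :
  complex.Re (\sum_i F i) = \sum_i complex.Re (F i).
Proof. exact: (big_morph _ ReD). Qed.

Lemma ReZ (a : R) (x : R[i]) : complex.Re (a%:C%C * x) = a * complex.Re x.
Proof. by case: x => x y /=; rewrite mul0r subr0. Qed.

Lemma hnormC f : (hnorm f)%:C%C = `|f|.
Proof. by rewrite /hnorm RRe_real// normr_real. Qed.

Lemma hnorm_sqr f : hnorm f ^+ 2 = complex.Re (ip f f).
Proof. by rewrite -norm_ip -hnormC -(rmorphXn (real_complex R)). Qed.

Lemma hnorm_ge0 f : 0 <= hnorm f.
Proof. by rewrite -ler0c hnormC. Qed.

Lemma hnorm_eq0 f : (hnorm f == 0) = (f == 0).
Proof. by rewrite -(inj_eq (@complexI R)) hnormC normr_eq0. Qed.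

Lemma ler_hnormD f g : hnorm (f + g) <= hnorm f + hnorm g.
Proof. by rewrite -lecR rmorphD/= !hnormC ler_normD. Qed.

Lemma hnormZ (a : R) f : hnorm (a%:C%C *: f) = `|a| * hnorm f.
Proof.
apply: (@complexI R); rewrite rmorphM/= !hnormC normrZ; congr (_ * _).
by rewrite normc_def/= expr0n addr0 sqrtr_sqr.
Qed.

Lemma hnorm_distC f g : hnorm (f - g) = hnorm (g - f).
Proof. by rewrite /hnorm distrC. Qed.

Lemma hnorm_sqr_sum (I : finType) (c : I -> R) (v : I -> H) :
  hnorm (\sum_i (c i)%:C%C *: v i) ^+ 2 =
  \sum_i \sum_j c i * c j * complex.Re (ip (v i) (v j)).
Proof.
rewrite hnorm_sqr linear_sumlz/= Re_sum; apply: eq_bigr => i _.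
rewrite linear_sumr Re_sum; apply: eq_bigr => j _.
have cE : Num.conj (c j)%:C%C = (c j)%:C%C by exact: conjc_real.
by rewrite linearZl_LR linearZr_LR/= cE !ReZ mulrA.
Qed.

End HilbertNorm.

Lemma Rintegral_sum d (T : measurableType d) (R : realType)
    (mu : {measure set T -> \bar R}) (I : finType) (f : I -> T -> R) :
    (forall i, mu.-integrable setT (EFin \o f i)) ->
  \int[mu]_x (\sum_i f i x) = \sum_i \int[mu]_x f i x.
Proof.
move=> intf; rewrite /Rintegral.
under eq_integral do rewrite -sumEFin.
rewrite (@integral_sum _ _ _ mu _ measurableT _ (fun i => EFin \o f i)) => [|i].
  by rewrite -sum_fine// => i _; exact: integrable_fin_num.
exact: intf.
Qed.

(** * Spectral measures as finite measures *)

Section SpectralMeasures.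
Context {R : realType} {H : hilbertType R} (E : resolution H).
Implicit Types f g h : H.

Lemma spectral_measure_itvoc h (a b : R) : a <= b ->
  spectral_measure E h `]a, b]%classic =
  (spectral_cdf E h b - spectral_cdf E h a)%:E.
Proof.
move=> ab; rewrite /= /spectral_measure /= /lebesgue_stieltjes_measure.
rewrite /measure_extension /=; rewrite measurable_mu_extE/=; last exact: is_ocitv.
by rewrite wlength_itv_bnd.
Qed.

Lemma spectral_cdf_ge0 h (l : R) : 0 <= spectral_cdf E h l.
Proof. by rewrite spectral_cdfE sqr_ge0. Qed.

(** Pythagoras: E l h and h - E l h are orthogonal. *)
Lemma spectral_cdf_le h (l : R) : spectral_cdf E h l <= hnorm h ^+ 2.
Proof.
have -> : hnorm h ^+ 2 = spectral_cdf E h l + hnorm (h - E l h) ^+ 2.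
  have eE : ip (E l h) (E l h) = ip (E l h) h.
    by rewrite -res_selfadjoint res_mul minxx.
  rewrite !hnorm_sqr linearBl/= !linearBr/= eE -res_selfadjoint subrr subr0.
  by rewrite -ReD addrC subrK.
by rewrite lerDl sqr_ge0.
Qed.

Lemma spectral_measure_lty h : (spectral_measure E h setT < +oo)%E.
Proof.
rewrite -(bigcup_itvT false false).
pose I n : set R := `]- (n%:R), n%:R]%classic.
have : (spectral_measure E h \o I) n @[n --> \oo] -->
    spectral_measure E h (\bigcup_n I n).
  apply: nondecreasing_cvg_mu; rewrite /I//; first exact: bigcup_measurable.
  by move=> *; apply/subsetPset/subset_itv; rewrite leBSide/= ?lerN2 ler_nat.
move=> /cvg_lim <- //; apply: (@le_lt_trans _ _ (hnorm h ^+ 2)%:E); last first.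
  by rewrite ltry.
apply: lime_le.
  apply: ereal_nondecreasing_is_cvgn => m n mn /=.
  apply: le_measure; rewrite ?inE /I//.
  by apply: subset_itv; rewrite leBSide/= ?lerN2 ler_nat.
apply: nearW => n /=; rewrite spectral_measure_itvoc ?ge0_cp// lee_fin.
by rewrite lerBlDr (le_trans (spectral_cdf_le _ _))// lerDl spectral_cdf_ge0.
Qed.

Lemma spectral_measure_fin_num h (A : set R) :
  measurable A -> spectral_measure E h A \is a fin_num.
Proof.
move=> mA; rewrite ge0_fin_numE//.
apply: (@le_lt_trans _ _ (spectral_measure E h setT)).
  by apply: le_measure; rewrite ?inE.
exact: spectral_measure_lty.
Qed.

Lemma spectral_cdfZ (c : R[i]) (r : R) h (l : R) : `|c| ^+ 2 = r%:C%C ->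
  spectral_cdf E (c *: h) l = r * spectral_cdf E h l.
Proof.
move=> cr; have EZ : E l (c *: h) = c *: E l h by exact: linearZ.
rewrite /spectral_cdf EZ linearZl_LR linearZr_LR/= mulrA.
by rewrite -normCK cr ReZ.
Qed.

(** A Lebesgue-Stieltjes measure is determined by its values on intervals
    ]a, b], and there it is an increment of the distribution function, which is
    quadratic in the vector. *)
Lemma spectral_measureZ (c : R[i]) (r : {nonneg R}) h (A : set R) :
    `|c| ^+ 2 = (r%:num)%:C%C -> measurable A ->
  spectral_measure E (c *: h) A = mscale r (spectral_measure E h) A.
Proof.
move=> cr mA; apply: lebesgue_stieltjes_measure_unique => // _ [x _ <-].
change (spectral_measure E (c *: h) `]x.1, x.2]%classic =
  r%:num%:E * spectral_measure E h `]x.1, x.2]%classic)%E.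
have [x12|x21] := leP x.1 x.2; last first.
  by rewrite set_itv_ge ?bnd_simp ?measure0 ?mule0// -leNgt ltW.
by rewrite !spectral_measure_itvoc// !(spectral_cdfZ _ _ cr) -mulrBr EFinM.
Qed.

Lemma spectral_measure0 (A : set R) : measurable A -> spectral_measure E 0 A = 0%E.
Proof.
move=> mA; have c0 : `|0 : R[i]| ^+ 2 = ((NngNum (lexx (0 : R)))%:num)%:C%C.
  by rewrite normr0 expr0n.
by have := spectral_measureZ 0 c0 mA; rewrite scale0r /mscale/= mul0e.
Qed.

Lemma Rintegral_spectral_measureZ (c : R[i]) (r : R) h (f : R -> R) :
    `|c| ^+ 2 = r%:C%C ->
    (spectral_measure E h).-integrable setT (EFin \o f) ->
  \int[spectral_measure E (c *: h)]_l f l =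
  r * \int[spectral_measure E h]_l f l.
Proof.
move=> cr intf; have r0 : 0 <= r by rewrite -ler0c -cr exprn_ge0.
rewrite /Rintegral.
rewrite (eq_measure_integral (mscale (NngNum r0) (spectral_measure E h))); last first.
  by move=> A mA _; exact: spectral_measureZ.
have mf := measurable_int _ intf.
rewrite [in LHS]integralE [in RHS]integralE.
rewrite !ge0_integral_mscale//; [|exact: measurable_funeneg|exact: measurable_funepos].
have pf := integrable_pos_fin_num measurableT intf.
have nf := integrable_neg_fin_num measurableT intf.
by rewrite -muleBr ?fin_num_adde_defl ?fin_numN// fineM// fin_numB pf nf.
Qed.

Lemma spectral_bounded_integrable h (f : R -> R) (M : R) : measurable_fun setT f ->
  (forall l, `|f l| <= M) -> (spectral_measure E h).-integrable setT (EFin \o f).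
Proof.
move=> mf fM; apply: measurable_bounded_integrable => //.
  exact: spectral_measure_lty.
by exists M; split; [exact: num_real|move=> N MN x _ /=; rewrite (le_trans (fM x)) ?ltW].
Qed.

Lemma measurable_cosM (t : R) : measurable_fun setT (fun l : R => cos (t * l)).
Proof.
apply: continuous_measurable_fun => l.
by apply: continuous_comp; [exact: mulrl_continuous|exact: continuous_cos].
Qed.

Lemma measurable_sinM (t : R) : measurable_fun setT (fun l : R => sin (t * l)).
Proof.
apply: continuous_measurable_fun => l.
by apply: continuous_comp; [exact: mulrl_continuous|exact: continuous_sin].
Qed.

Lemma integrable_cosM h (t : R) :
  (spectral_measure E h).-integrable setT (EFin \o (fun l => cos (t * l))).
Proof.
exact: (spectral_bounded_integrable h (measurable_cosM t) (fun l => cos_max (t * l))).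
Qed.

Lemma integrable_sinM h (t : R) :
  (spectral_measure E h).-integrable setT (EFin \o (fun l => sin (t * l))).
Proof.
exact: (spectral_bounded_integrable h (measurable_sinM t) (fun l => sin_max (t * l))).
Qed.

End SpectralMeasures.

(** * The isometry between orbits and exponentials *)

Section SpectralIsometry.
Context {R : realType} {H : hilbertType R} (E : resolution H).
Context (U : R -> {linear H -> H}).
Context (hU : unitary_group U) (hE : spectral_resolution E U).

(** On the diagonal the polarization formula collapses: the four vectors are
    (1 + i^k) h, with spectral measures 4, 2, 0 and 2 times that of h. The sines
    of k = 1 and k = 3 enter with opposite signs and cancel. *)
Lemma Re_ip_unitary h (t : R) :
  complex.Re (ip (U t h) h) = \int[spectral_measure E h]_l cos (t * l).
Proof.
set C := \int[spectral_measure E h]_l cos (t * l).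
set S := \int[spectral_measure E h]_l sin (t * l).
(* r k = |1 + i^k|^2, kept unevaluated until the sum over k is expanded *)
pose r k := complex.Re (1 + 'i%C ^+ k : R[i]) ^+ 2 +
  complex.Im (1 + 'i%C ^+ k : R[i]) ^+ 2.
have Iscale k : spectral_integral_diag E
    (fun l => cos (t * l) +i* sin (t * l))%C (h + 'i%C ^+ k *: h) =
    (r k * C +i* (r k * S))%C.
  have nr : `|1 + 'i%C ^+ k| ^+ 2 = (r k)%:C%C by rewrite -add_Re2_Im2.
  have -> : h + 'i%C ^+ k *: h = (1 + 'i%C ^+ k) *: h.
    by rewrite scalerDl scale1r.
  congr (_ +i* _)%C; rewrite (Rintegral_spectral_measureZ nr)//.
    exact: integrable_cosM.
  exact: integrable_sinM.
rewrite hE /spectral_integral.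
under eq_bigr do rewrite Iscale.
move: C S {Iscale} => C S; rewrite !big_ord_recl big_ord0 /r /bump/=.
by field.
Qed.

Lemma Re_ip_unitaryB h (s t : R) :
  complex.Re (ip (U s h) (U t h)) =
  \int[spectral_measure E h]_l cos ((s - t) * l).
Proof.
rewrite -Re_ip_unitary -(proj1 (ug_unitary hU t) (U (s - t) h) h).
by rewrite -(ugD hU) [t + _]addrC subrK.
Qed.

(** Both sides expand into the double sum of c_i c_j int cos ((tau_i - tau_j) l),
    by unitarity on the left and by the formula for the cosine of a difference on
    the right. *)
Lemma hnorm_exp_sum h (I : finType) (c tau : I -> R) :
  hnorm (\sum_i (c i)%:C%C *: U (tau i) h) ^+ 2 =
  \int[spectral_measure E h]_l
    ((\sum_i c i * cos (tau i * l)) ^+ 2 + (\sum_i c i * sin (tau i * l)) ^+ 2).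
Proof.
have sumE (l : R) : (\sum_i c i * cos (tau i * l)) ^+ 2 +
    (\sum_i c i * sin (tau i * l)) ^+ 2 =
    \sum_i \sum_j c i * c j * cos ((tau i - tau j) * l).
  rewrite !expr2 !mulr_suml -big_split/=; apply: eq_bigr => i _.
  rewrite !mulr_sumr -big_split/=; apply: eq_bigr => j _.
  by rewrite mulrBl cosB; ring.
under eq_Rintegral do rewrite sumE.
under eq_Rintegral do rewrite pair_big/=.
rewrite hnorm_sqr_sum pair_big/= Rintegral_sum//; last first.
  move=> [i j] /=; apply: (@spectral_bounded_integrable _ _ E h _ `|c i * c j|).
    by apply: measurable_funM => //; exact: measurable_cosM.
  by move=> l; rewrite normrM ler_piMr ?cos_max.
apply: eq_bigr => -[i j] _ /=.
by rewrite RintegralZl ?Re_ip_unitaryB//; exact: integrable_cosM.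
Qed.

End SpectralIsometry.

(** * Scalar Riemann sums *)

Section ScalarRiemannSums.
Context {R : realType}.
Implicit Types (a b d t : R) (s : seq R) (tag : nat -> R) (f F : R -> R).

(** The condition on tagged partitions in [is_riemann_integral]: mesh below d. *)
Definition fine_tagging a s tag d := forall i, (i < size s)%N ->
  nth a s i - nth a (a :: s) i < d /\ nth a (a :: s) i <= tag i <= nth a s i.

(** The analogue of [riemann_sum] for scalar functions. *)
Definition rsum f a s tag : R :=
  \sum_(i < size s) (nth a s i - nth a (a :: s) i) * f (tag i).

Lemma itv_partition_step a b s i : itv_partition a b s -> (i < size s)%N ->
  nth a (a :: s) i < nth a s i.
Proof. by move=> [/(pathP a)/(_ i)]. Qed.

Lemma itv_partition_telescope (V : zmodType) (G : R -> V) a b s :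
    itv_partition a b s ->
  \sum_(i < size s) (G (nth a s i) - G (nth a (a :: s) i)) = G b - G a.
Proof.
move=> [_ /eqP <-].
rewrite -(big_mkord xpredT (fun i => G (nth a s i) - G (nth a (a :: s) i))).
rewrite (telescope_sumr (fun i => G (nth a (a :: s) i)))//=.
by rewrite -[size s]/((size (a :: s)).-1) nth_last.
Qed.

Lemma rsum_le f a b s tag (M : R) : (forall t, `|f t| <= M) -> itv_partition a b s ->
  `|rsum f a s tag| <= M * (b - a).
Proof.
move=> fM abs; rewrite -(itv_partition_telescope id abs) mulr_sumr.
rewrite (le_trans (ler_norm_sum _ _ _))//; apply: ler_sum => i _.
have step := itv_partition_step abs (ltn_ord i).
by rewrite /= normrM gtr0_norm ?subr_gt0// mulrC ler_wpM2r ?fM// subr_ge0 ltW.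
Qed.

(** By the mean value theorem each increment of F is the step times a value of f
    in the same cell, and there f varies by at most L d. *)
Lemma rsum_primitive f F a b s tag d (L : R) : 0 <= L ->
    (forall t, is_derive t 1 F (f t)) ->
    (forall t t', `|f t - f t'| <= L * `|t - t'|) ->
    itv_partition a b s -> fine_tagging a s tag d ->
  `|rsum f a s tag - (F b - F a)| <= L * d * (b - a).
Proof.
move=> L0 dF lipf abs tagd; rewrite -(itv_partition_telescope F abs) -sumrB.
rewrite -(itv_partition_telescope id abs) mulr_sumr.
rewrite (le_trans (ler_norm_sum _ _ _))//; apply: ler_sum => i _.
set y := nth a s i; set x := nth a (a :: s) i.
have [xyd /andP[xt ty]] := tagd i (ltn_ord i).
have xy : x < y by exact: (itv_partition_step abs).
have cF : {within `[x, y], continuous F}.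
  apply: continuous_subspaceT => z; apply: differentiable_continuous.
  by apply/derivable1_diffP; have [] := dF z.
have [c] := MVT xy (fun z _ => dF z) cF.
rewrite in_itv/= => /andP[xc cy] ->.
rewrite [_ * (y - x)]mulrC -mulrBr normrM gtr0_norm ?subr_gt0// mulrC.
rewrite ler_wpM2r ?subr_ge0 ?(ltW xy)// (le_trans (lipf _ _))// ler_wpM2l//.
rewrite ler_norml; move: xyd xt ty; rewrite -/x -/y => xyd xt ty.
by apply/andP; split; lra.
Qed.

(** The left end point a is not listed, as required by [itv_partition]. *)
Definition uniform_partition a b n : seq R :=
  mkseq (fun i => a + (b - a) * i.+1%:R / n.+1%:R) n.+1.

Lemma uniform_partition_prev a b n i : (i < n.+1)%N ->
  nth a (a :: uniform_partition a b n) i = a + (b - a) * i%:R / n.+1%:R.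
Proof.
by case: i => [|i] ni; rewrite /= ?mulr0 ?mul0r ?addr0// nth_mkseq// ltnW.
Qed.

Lemma uniform_partitionP a b n : a < b -> itv_partition a b (uniform_partition a b n).
Proof.
move=> ab; have n0 : 0 < n.+1%:R :> R by rewrite ltr0n.
split.
  apply/(pathP a) => i; rewrite size_mkseq => ni.
  rewrite uniform_partition_prev// nth_mkseq//.
  by rewrite ltrD2l ltr_pM2r ?invr_gt0// ltr_pM2l ?subr_gt0// ltr_nat.
rewrite -nth_last size_mkseq nth_mkseq//= mulfK ?pnatr_eq0//.
by rewrite addrC subrK.
Qed.

Lemma uniform_partition_fine a b n d : a < b -> (b - a) / n.+1%:R < d ->
  fine_tagging a (uniform_partition a b n)
    (nth a (a :: uniform_partition a b n)) d.
Proof.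
move=> ab nd i; rewrite size_mkseq => ni; split.
  rewrite uniform_partition_prev// nth_mkseq//; apply: le_lt_trans nd.
  have e (x y : R) : a + (y + x) - (a + y) = x by ring.
  by rewrite -[i.+1%:R]natr1 mulrDr mulr1 mulrDl e.
rewrite lexx ltW//; apply: (itv_partition_step (uniform_partitionP n ab)).
by rewrite size_mkseq.
Qed.

Lemma fine_partition_exists a b d : a < b -> 0 < d ->
  exists s tag, itv_partition a b s /\ fine_tagging a s tag d.
Proof.
move=> ab d0; pose n := truncn ((b - a) / d).
exists (uniform_partition a b n), (nth a (a :: uniform_partition a b n)).
split; first exact: uniform_partitionP.
apply: uniform_partition_fine => //.
by rewrite ltr_pdivrMr ?ltr0n// mulrC -ltr_pdivrMr// truncnS_gt.
Qed.

End ScalarRiemannSums.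

(** * Exponential integrals and the Fejer kernel *)

Section FejerKernel.
Context {R : realType}.
Implicit Types (a b d t l x y : R) (s : seq R) (tag : nat -> R).

Lemma ler_dist_of_derivative (f df : R -> R) x y :
    (forall z : R, is_derive z 1 f (df z)) -> (forall z, `|df z| <= 1) ->
  `|f x - f y| <= `|x - y|.
Proof.
move=> fdf df1; wlog xy : x y / x < y => [wlg|].
  have [xy|yx|->] := ltgtP x y; [exact: wlg| |by rewrite !subrr !normr0].
  by rewrite distrC (distrC x); exact: wlg.
have cf : {within `[x, y], continuous f}.
  apply: continuous_subspaceT => z; apply: differentiable_continuous.
  by apply/derivable1_diffP; have [] := fdf z.
have [c _ e] := MVT xy (fun z _ => fdf z) cf.
by rewrite distrC e (distrC x) normrM ler_piMl.
Qed.

Lemma ler_dist_cos x y : `|cos x - cos y| <= `|x - y|.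
Proof.
apply: (@ler_dist_of_derivative cos (fun z => - sin z)) => z.
by rewrite normrN sin_max.
Qed.

Lemma ler_dist_sin x y : `|sin x - sin y| <= `|x - y|.
Proof. exact: (@ler_dist_of_derivative sin cos _ _ (@is_derive_sin R) (@cos_max R)). Qed.

Lemma ler_norm_sin x : `|sin x| <= `|x|.
Proof. by have := ler_dist_sin x 0; rewrite sin0 !subr0. Qed.

(** Antiderivatives of cos (t l) and sin (t l) in t. The case l = 0 is separate:
    the quotients would be 0 by convention, while cos (t * 0) = 1 has primitive t. *)
Definition cos_primitive l t : R := if l == 0 then t else sin (t * l) / l.
Definition sin_primitive l t : R := if l == 0 then 0 else - cos (t * l) / l.

Lemma is_derive_cos_primitive l t : is_derive t 1 (cos_primitive l) (cos (t * l)).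
Proof.
rewrite /cos_primitive; case: eqP => [->|/eqP l0].
  by rewrite mulr0 cos0; exact: is_derive_id.
apply: is_derive_eq.
by rewrite /GRing.scale/=; field.
Qed.

Lemma is_derive_sin_primitive l t : is_derive t 1 (sin_primitive l) (sin (t * l)).
Proof.
rewrite /sin_primitive; case: eqP => [->|/eqP l0].
  by rewrite mulr0 sin0; exact: is_derive_cst.
apply: is_derive_eq.
by rewrite /GRing.scale/=; field.
Qed.

Lemma rsum_cos a b s tag d l : itv_partition a b s -> fine_tagging a s tag d ->
  `|rsum (fun t => cos (t * l)) a s tag - (cos_primitive l b - cos_primitive l a)|
    <= `|l| * d * (b - a).
Proof.
apply: rsum_primitive => // [t|t t']; first exact: is_derive_cos_primitive.
by rewrite (le_trans (ler_dist_cos _ _))// -mulrBl normrM mulrC.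
Qed.

Lemma rsum_sin a b s tag d l : itv_partition a b s -> fine_tagging a s tag d ->
  `|rsum (fun t => sin (t * l)) a s tag - (sin_primitive l b - sin_primitive l a)|
    <= `|l| * d * (b - a).
Proof.
apply: rsum_primitive => // [t|t t']; first exact: is_derive_sin_primitive.
by rewrite (le_trans (ler_dist_sin _ _))// -mulrBl normrM mulrC.
Qed.

(** The minimum records two bounds at once: 1 comes from |F| <= 1 and gives an
    integrable dominating function, (l d)^2 comes from comparison with the common
    limit G and gives convergence as the mesh d tends to 0. *)
Lemma rsum_close (F : R -> R) (G : R) a b s tag d s' tag' l :
    (forall t, `|F t| <= 1) ->
    (forall s tag, itv_partition a b s -> fine_tagging a s tag d ->
      `|rsum F a s tag - G| <= `|l| * d * (b - a)) ->
    itv_partition a b s -> fine_tagging a s tag d ->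
    itv_partition a b s' -> fine_tagging a s' tag' d ->
  (rsum F a s tag - rsum F a s' tag') ^+ 2 <=
    4 * (b - a) ^+ 2 * Num.min 1 ((l * d) ^+ 2).
Proof.
move=> F1 FG abs tagd abs' tagd'.
have p1 := rsum_le tag F1 abs; have q1 := rsum_le tag' F1 abs'.
have p2 := FG _ _ abs tagd; have q2 := FG _ _ abs' tagd'.
have sqr_bound (x y : R) : `|x| <= y -> x ^+ 2 <= y ^+ 2.
  by move=> xy; rewrite -real_normK ?num_real// lerXn2r ?nnegrE// (le_trans _ xy).
rewrite minEle; case: ifPn => _.
  have -> : 4 * (b - a) ^+ 2 * 1 = (2 * (b - a)) ^+ 2 by ring.
  apply: sqr_bound; rewrite (le_trans (ler_normB _ _))//; lra.
have -> : 4 * (b - a) ^+ 2 * (l * d) ^+ 2 = (2 * (`|l| * d * (b - a))) ^+ 2.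
  by rewrite !exprMn real_normK ?num_real//; ring.
apply: sqr_bound.
have -> : rsum F a s tag - rsum F a s' tag' =
  (rsum F a s tag - G) - (rsum F a s' tag' - G) by ring.
by rewrite (le_trans (ler_normB _ _))//; lra.
Qed.

(** The square of the modulus of the mean of e^{i tau l} over an interval of length
    T; the value at l = 0 is the continuous extension. *)
Definition fejer T l : R := if l == 0 then 1 else (sin (T * l / 2) / (T * l / 2)) ^+ 2.

(** The left side is |int_a^b e^{i t l} dt|^2, computed by
    (2 sin (x / 2))^2 = 2 - 2 cos x with x = (b - a) l. *)
Lemma fejerE a b l : a < b ->
  (cos_primitive l b - cos_primitive l a) ^+ 2 +
  (sin_primitive l b - sin_primitive l a) ^+ 2 = (b - a) ^+ 2 * fejer (b - a) l.
Proof.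
move=> ab; rewrite /fejer /cos_primitive /sin_primitive; case: eqP => [_|/eqP l0].
  by rewrite subrr expr0n addr0 mulr1.
have ba0 : b - a != 0 by rewrite gt_eqF// subr_gt0.
have e : 4 * sin ((b - a) * l / 2) ^+ 2 = 2 - 2 * cos ((b - a) * l).
  have -> : (b - a) * l = ((b - a) * l / 2) *+ 2 by rewrite mulr2n -splitr.
  by rewrite cos_mulr2n cos2sin2 -[X in sin (X / 2)]mulr_natr mulfK//; ring.
have -> : (b - a) ^+ 2 * (sin ((b - a) * l / 2) / ((b - a) * l / 2)) ^+ 2 =
    4 * sin ((b - a) * l / 2) ^+ 2 / l ^+ 2 by field; rewrite l0 ba0.
have cE : cos ((b - a) * l) =
  cos (b * l) * cos (a * l) + sin (b * l) * sin (a * l) by rewrite mulrBl cosB.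
rewrite e cE.
have sc x : sin x ^+ 2 = 1 - cos x ^+ 2 by rewrite sin2cos2.
transitivity ((sin (b * l) ^+ 2 + cos (b * l) ^+ 2 +
  (sin (a * l) ^+ 2 + cos (a * l) ^+ 2) -
  2 * (cos (b * l) * cos (a * l) + sin (b * l) * sin (a * l))) / l ^+ 2).
  by field.
by rewrite !sc !subrK; congr (_ / _); ring.
Qed.

Lemma fejer_ge0 T l : 0 <= fejer T l.
Proof. by rewrite /fejer; case: ifP => // _; rewrite sqr_ge0. Qed.

Lemma fejer_le1 T l : fejer T l <= 1.
Proof.
rewrite /fejer; case: ifP => // _; rewrite -real_normK ?num_real//.
rewrite exprn_ile1// normrM normfV.
have [->|x0] := eqVneq (T * l / 2) 0; first by rewrite normr0 invr0 mulr0.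
by rewrite ler_pdivrMr ?normr_gt0// mul1r ler_norm_sin.
Qed.

Lemma fejer_le T l : 0 < T -> l != 0 -> fejer T l <= (2 / (T * l)) ^+ 2.
Proof.
move=> T0 l0; rewrite /fejer (negbTE l0) -[leRHS]mul1r.
have -> : (sin (T * l / 2) / (T * l / 2)) ^+ 2 =
    sin (T * l / 2) ^+ 2 * (2 / (T * l)) ^+ 2.
  by field; rewrite l0 gt_eqF.
by rewrite ler_wpM2r ?sqr_ge0// -real_normK ?num_real// exprn_ile1// sin_max.
Qed.

Lemma rsum_fejer_cvg a b l : a < b ->
  let s := uniform_partition a b in
  let tag n := nth a (a :: s n) in
  (rsum (fun t => cos (t * l)) a (s n) (tag n)) ^+ 2 +
  (rsum (fun t => sin (t * l)) a (s n) (tag n)) ^+ 2 @[n --> \oo]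
  --> (b - a) ^+ 2 * fejer (b - a) l.
Proof.
move=> ab s tag; rewrite -fejerE//.
have cvgF (F G : R -> R) :
    (forall d s tag, itv_partition a b s -> fine_tagging a s tag d ->
      `|rsum F a s tag - (G b - G a)| <= `|l| * d * (b - a)) ->
    rsum F a (s n) (tag n) @[n --> \oo] --> G b - G a.
  move=> FG; apply/cvgrPdist_le => e e0.
  pose d := e / ((`|l| + 1) * (b - a)).
  have c0 : 0 < (`|l| + 1) * (b - a) by rewrite mulr_gt0 ?subr_gt0// ltr_pwDr.
  have d0 : 0 < d by rewrite divr_gt0.
  have cv0 : (b - a) / n.+1%:R @[n --> \oo] --> (0 : R).
    by rewrite -(mulr0 (b - a)); apply: cvgMr; exact: cvg_harmonic.
  near=> n; rewrite distrC.
  have nd : (b - a) / n.+1%:R < d.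
    by near: n; exact: (cvgr_lt _ cv0 _ d0).
  apply: (le_trans (FG d _ _ (uniform_partitionP n ab) (uniform_partition_fine ab nd))).
  rewrite -mulrA mulrCA /d mulrAC ler_pdivrMr// ler_wpM2l// ?(ltW e0)//.
  by rewrite ler_wpM2r ?subr_ge0 ?(ltW ab)// lerDl.
have cC := cvgF _ _ (fun d s tag => @rsum_cos a b s tag d l).
have cS := cvgF _ _ (fun d s tag => @rsum_sin a b s tag d l).
by apply: cvgD; apply: cvgM.
Unshelve. all: by end_near. Qed.

End FejerKernel.

(** * Riemann integrals of orbits and time averages *)

Section TimeAverages.
Context {R : realType} {H : hilbertType R} (E : resolution H).
Context (U : R -> {linear H -> H}).
Context (hU : unitary_group U) (hE : spectral_resolution E U).
Implicit Types (a b d l : R) (s : seq R) (tag : nat -> R) (f g h : H).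

Local Notation sums h := (riemann_sum (fun t => U t h)).
Local Notation csum l := (rsum (fun t => cos (t * l))).
Local Notation ssum l := (rsum (fun t => sin (t * l))).

Lemma hnorm_riemann_sum h a s tag :
  hnorm (sums h a s tag) ^+ 2 =
  \int[spectral_measure E h]_l ((csum l a s tag) ^+ 2 + (ssum l a s tag) ^+ 2).
Proof. exact: (hnorm_exp_sum hU hE). Qed.

(** The isometry is applied to the disjoint union of the two index sets, the
    second with opposite coefficients, which compares two partitions without a common
    refinement. *)
Lemma hnorm_riemann_sumB h a s tag s' tag' :
  hnorm (sums h a s tag - sums h a s' tag') ^+ 2 =
  \int[spectral_measure E h]_l ((csum l a s tag - csum l a s' tag') ^+ 2 +
    (ssum l a s tag - ssum l a s' tag') ^+ 2).
Proof.
pose step s i := nth a s i - nth a (a :: s) i.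
pose c (i : 'I_(size s) + 'I_(size s')) :=
  match i with inl i => step s i | inr i => - step s' i end.
pose tau (i : 'I_(size s) + 'I_(size s')) :=
  match i with inl i => tag i | inr i => tag' i end.
have := hnorm_exp_sum hU hE h c tau.
rewrite big_sumType/=; under [X in _ + X]eq_bigr do rewrite rmorphN scaleNr.
rewrite sumrN => ->; apply: eq_Rintegral => l _.
rewrite !big_sumType/=.
under [X in (_ + X) ^+ 2 + _]eq_bigr do rewrite mulNr.
under [X in _ + (_ + X) ^+ 2]eq_bigr do rewrite mulNr.
by rewrite !sumrN.
Qed.

Lemma measurable_rsum (phi : R -> R) a s tag :
    (forall t, measurable_fun setT (fun l : R => phi (t * l))) ->
  measurable_fun setT (fun l => rsum (fun t => phi (t * l)) a s tag).
Proof.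
by move=> mphi; apply: measurable_sum => i; apply: measurable_funM.
Qed.

Lemma measurable_min1 d : measurable_fun setT (fun l => Num.min 1 ((l * d) ^+ 2)).
Proof.
by apply: measurable_minr => //; apply: measurable_funX; apply: measurable_funM.
Qed.

Lemma bounded_cvg_Rintegral h (f_ : nat -> R -> R) (f : R -> R) (M : R) :
    (forall n, measurable_fun setT (f_ n)) -> (forall n l, `|f_ n l| <= M) ->
    (forall l, f_ n l @[n --> \oo] --> f l) ->
  \int[spectral_measure E h]_l f_ n l @[n --> \oo] -->
  \int[spectral_measure E h]_l f l.
Proof.
move=> mf fM cf; pose mu := spectral_measure E h.
have mlim : measurable_fun setT f.
  exact: (@measurable_fun_cvg _ _ _ _ _ _ mf (fun l _ => cf l)).
have iM : mu.-integrable setT (EFin \o cst M).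
  apply: (@spectral_bounded_integrable _ _ E h _ `|M|) => //.
have [] := @dominated_convergence _ _ _ mu _ measurableT
    (fun n => EFin \o f_ n) (EFin \o f) (EFin \o cst M).
- by move=> n; apply: (measurableT_comp _ (mf n)).
- by apply: (measurableT_comp _ mlim).
- by apply: aeW => l _; apply/cvg_EFin; [exact: nearW|exact: cf].
- exact: iM.
- by apply: aeW => l n _ /=; rewrite lee_fin.
move=> intf _ cv; apply: fine_cvg; rewrite fineK//.
exact: integrable_fin_num intf.
Qed.

Lemma Rintegral_min1_cvg0 h :
  \int[spectral_measure E h]_l Num.min 1 ((l * n.+1%:R^-1) ^+ 2) @[n --> \oo]
  --> (0 : R).
Proof.
have -> : 0 = \int[spectral_measure E h]_l 0 :> R by rewrite Rintegral_cst ?mul0r.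
have min1_ge0 (x : R) : 0 <= Num.min 1 (x ^+ 2) by rewrite le_min ler01 sqr_ge0.
apply: (bounded_cvg_Rintegral (M := 1)) => [n|n l|l].
- exact: measurable_min1.
- by rewrite ger0_norm// ge_min lexx.
apply: (@squeeze_cvgr _ _ _ _ (cst 0) (fun n => (l * n.+1%:R^-1) ^+ 2)).
- by apply: nearW => n; rewrite min1_ge0 ge_min lexx orbT.
- exact: cvg_cst.
have c0 : l * n.+1%:R^-1 @[n --> \oo] --> (0 : R).
  by rewrite -(mulr0 l); apply: cvgMr; exact: cvg_harmonic.
by rewrite -(mulr0 0); apply: cvgM.
Qed.

(** The spectral integral of min(1, (l d)^2) tends to 0 with d by dominated
    convergence, and controls the square of the distance of any two Riemann sums
    of mesh less than d. *)
Lemma riemann_sum_cauchy h a b e : a < b -> 0 < e -> exists2 d, 0 < d &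
  forall s tag s' tag',
    itv_partition a b s -> fine_tagging a s tag d ->
    itv_partition a b s' -> fine_tagging a s' tag' d ->
    hnorm (sums h a s tag - sums h a s' tag') < e.
Proof.
move=> ab e0; pose K := 8 * (b - a) ^+ 2.
have K0 : 0 < K by rewrite mulr_gt0// exprn_gt0// subr_gt0.
have eK : 0 < e ^+ 2 / K by rewrite divr_gt0// exprn_gt0.
have [n _ /(_ n (leqnn n)) /= small] := cvgr_lt _ (@Rintegral_min1_cvg0 h) _ eK.
exists n.+1%:R^-1; first by rewrite invr_gt0.
move=> s tag s' tag' abs tagd abs' tagd'.
rewrite -(ltr_pXn2r (n := 2))// ?nnegrE ?hnorm_ge0 ?(ltW e0)//.
move: small; rewrite ltr_pdivlMr// mulrC => /(le_lt_trans _); apply.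
pose d := n.+1%:R^-1 : R.
have intK : (spectral_measure E h).-integrable setT
    (EFin \o (fun l => K * Num.min 1 ((l * d) ^+ 2))).
  apply: (@spectral_bounded_integrable _ _ E h _ K).
    by apply: measurable_funM => //; exact: measurable_min1.
  move=> l; rewrite normrM (gtr0_norm K0) ler_piMr ?(ltW K0)//.
  by rewrite ger0_norm ?ge_min ?lexx// le_min ler01 sqr_ge0.
have bound : forall l, (csum l a s tag - csum l a s' tag') ^+ 2 +
    (ssum l a s tag - ssum l a s' tag') ^+ 2 <= K * Num.min 1 ((l * d) ^+ 2).
  move=> l; have C := rsum_close (fun t => cos_max (t * l))
    (fun s tag => @rsum_cos _ a b s tag d l) abs tagd abs' tagd'.
  have S := rsum_close (fun t => sin_max (t * l))
    (fun s tag => @rsum_sin _ a b s tag d l) abs tagd abs' tagd'.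
  by apply: (le_trans (lerD C S)); rewrite /K; lra.
rewrite hnorm_riemann_sumB -RintegralZl//; last first.
  apply: (@spectral_bounded_integrable _ _ E h _ 1); first exact: measurable_min1.
  by move=> l; rewrite ger0_norm ?ge_min ?lexx// le_min ler01 sqr_ge0.
apply: (le_Rintegral measurableT _ intK (fun l _ => bound l)).
apply: le_integrable intK => //.
  apply/measurable_EFinP; apply: measurable_funD; apply: measurable_funX;
    by apply: measurable_funB; apply: measurable_rsum => t;
      [exact: measurable_cosM || exact: measurable_sinM..
      ].
move=> l _ /=; rewrite lee_fin ger0_norm ?addr_ge0 ?sqr_ge0//.
by rewrite (le_trans (bound l))// ler_norm.
Qed.

Lemma measurable_rsum_sqr a s tag : measurable_fun setT
  (fun l => (csum l a s tag) ^+ 2 + (ssum l a s tag) ^+ 2).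
Proof.
by apply: measurable_funD; apply: measurable_funX; apply: measurable_rsum => t;
  [exact: measurable_cosM|exact: measurable_sinM].
Qed.

(** A pointwise limit of continuous functions, namely of scalar Riemann sums. *)
Lemma measurable_fejer (T : R) : 0 < T -> measurable_fun setT (fejer T).
Proof.
move=> T0; apply: (measurable_fun_cvg (h := fun n l =>
  T ^- 2 * ((csum l 0 (uniform_partition 0 T n)
     (nth 0 (0 :: uniform_partition 0 T n))) ^+ 2 +
   (ssum l 0 (uniform_partition 0 T n)
     (nth 0 (0 :: uniform_partition 0 T n))) ^+ 2))).
  by move=> n; apply: measurable_funM => //; exact: measurable_rsum_sqr.
move=> l _; have := @rsum_fejer_cvg _ 0 T l T0; rewrite /= subr0 => cv.
have -> : fejer T l = T ^- 2 * (T ^+ 2 * fejer T l).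
  by rewrite mulrA mulVf ?mul1r// expf_neq0// gt_eqF.
exact: cvgMr cv.
Qed.

Lemma integrable_fejer h (T : R) : 0 < T ->
  (spectral_measure E h).-integrable setT (EFin \o fejer T).
Proof.
move=> T0; apply: (@spectral_bounded_integrable _ _ E h _ 1).
  exact: measurable_fejer.
by move=> l; rewrite ger0_norm ?fejer_le1// fejer_ge0.
Qed.

(** The limit of the uniform Riemann sums exists by completeness, and all fine
    sums are close to it. Its norm comes from passing to the limit in the isometry. *)
Lemma riemann_integral_exists h a b : a < b ->
  exists2 v, is_riemann_integral (fun t => U t h) a b v &
    hnorm v ^+ 2 = (b - a) ^+ 2 * \int[spectral_measure E h]_l fejer (b - a) l.
Proof.
move=> ab; pose s := uniform_partition a b.
pose tag n := nth a (a :: s n).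
pose u n := sums h a (s n) (tag n).
have fine_u d : 0 < d -> \forall n \near \oo, fine_tagging a (s n) (tag n) d.
  move=> d0; have cv0 : (b - a) / n.+1%:R @[n --> \oo] --> (0 : R).
    by rewrite -(mulr0 (b - a)); apply: cvgMr; exact: cvg_harmonic.
  by near=> n; apply: uniform_partition_fine => //; near: n; exact: (cvgr_lt _ cv0 _ d0).
have cu : cvgn u.
  apply/cauchy_cvgP/cauchy_ballP => -[e ei]; rewrite ltcE/= => /andP[/eqP ei0 e0].
  have [d d0 ud] := riemann_sum_cauchy h ab e0.
  near_simpl; near=> m n; rewrite -ball_normE/= -hnormC ei0 ltcR; apply: ud.
  - exact: uniform_partitionP.
  - by near: m; exact: fine_u.
  - exact: uniform_partitionP.
  - by near: n; exact: fine_u.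
pose v := limn u.
have near_v e : 0 < e -> \forall n \near \oo, hnorm (u n - v) < e.
  move=> e0; have /cvgrPdist_lt/(_ e%:C%C) := cu; rewrite ltcR => /(_ e0).
  by apply: filterS => n; rewrite distrC -hnormC ltcR.
exists v => [e e0|].
  have e20 : 0 < e / 2 by rewrite divr_gt0.
  have [d d0 ud] := riemann_sum_cauchy h ab e20.
  exists d => // s' tag' abs' tagd'; near \oo => n.
  rewrite -(subrK (u n) (riemann_sum _ _ _ _)) -addrA.
  rewrite (le_lt_trans (ler_hnormD _ _))// [ltRHS]splitr ltrD//.
    apply: ud => //; first exact: uniform_partitionP.
    by near: n; exact: fine_u.
  by near: n; exact: near_v.
have cv_norm : hnorm (u n) ^+ 2 @[n --> \oo] --> hnorm v ^+ 2.
  have cv1 : hnorm (u n) @[n --> \oo] --> hnorm v.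
    apply/cvgrPdist_lt => e /near_v; apply: filterS => n; apply: le_lt_trans.
    rewrite ler_norml lerBrDr lerBlDl; apply/andP; split.
      rewrite addrC lerBlDr -{1}(subrK v (u n)) addrC.
      exact: ler_hnormD.
    by rewrite hnorm_distC -{1}(subrK (u n) v) addrC; exact: ler_hnormD.
  exact: cvgM.
rewrite -RintegralZl//; last by apply: integrable_fejer; rewrite subr_gt0.
suff cv_energy : hnorm (u n) ^+ 2 @[n --> \oo] -->
    \int[spectral_measure E h]_l ((b - a) ^+ 2 * fejer (b - a) l).
  exact: cvg_unique cv_norm cv_energy.
rewrite (eq_cvg _ _ (fun n => hnorm_riemann_sum h a (s n) (tag n))).
apply: (bounded_cvg_Rintegral (M := 2 * (b - a) ^+ 2)) => [n|n l|l].
- exact: measurable_rsum_sqr.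
- have abs := uniform_partitionP n ab.
  have C := rsum_le (tag n) (fun t => cos_max (t * l)) abs.
  have S := rsum_le (tag n) (fun t => sin_max (t * l)) abs.
  rewrite ger0_norm ?addr_ge0 ?sqr_ge0// mulr_natl mulr2n.
  rewrite -(real_normK (num_real (csum _ _ _ _))) -(real_normK (num_real (ssum _ _ _ _))).
  by rewrite mul1r in C S; apply: lerD; rewrite lerXn2r ?nnegrE ?subr_ge0 ?(ltW ab).
- exact: rsum_fejer_cvg.
Unshelve. all: by end_near. Qed.

Lemma riemann_integral_unique (F : R -> H) a b v w : a < b ->
  is_riemann_integral F a b v -> is_riemann_integral F a b w -> v = w.
Proof.
move=> ab Fv Fw; apply/eqP; rewrite -subr_eq0 -hnorm_eq0 eq_le hnorm_ge0 andbT.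
apply/ler_addgt0Pl => e e0; rewrite addr0.
have e20 : 0 < e / 2 by rewrite divr_gt0.
have [d1 d10 Fd1] := Fv _ e20; have [d2 d20 Fd2] := Fw _ e20.
have d0 : 0 < Num.min d1 d2 by rewrite lt_min d10 d20.
have [s [tag [abs tagd]]] := fine_partition_exists ab d0.
have tagd1 : fine_tagging a s tag d1.
  by move=> i /tagd[]; rewrite lt_min => /andP[].
have tagd2 : fine_tagging a s tag d2.
  by move=> i /tagd[]; rewrite lt_min => /andP[].
rewrite -(subrK (riemann_sum F a s tag) v) -addrA.
rewrite (le_trans (ler_hnormD _ _))// [leRHS]splitr lerD// ltW//.
  by rewrite hnorm_distC; exact: Fd1.
exact: Fd2.
Qed.

(** The orbit of f is the orbit of f - P f translated by the fixed vector P f, so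
    its Riemann integral is that of f - P f plus (t - s) P f. *)
Lemma time_averageE (P : H -> H) f (t s : R) : s < t ->
    orthogonal_projection (fixed_space U) P ->
  hnorm (time_average U t s f - P f) ^+ 2 =
  \int[spectral_measure E (f - P f)]_l fejer (t - s) l.
Proof.
move=> st hP; have ts0 : 0 < t - s by rewrite subr_gt0.
have [w hw wE] := riemann_integral_exists (f - P f) st.
have UPf tau : U tau (P f) = P f by have [+ _] := hP f; exact.
have If : is_riemann_integral (fun tau => U tau f) s t (w + (t - s)%:C%C *: P f).
  move=> e /hw[d d0 hd]; exists d => // p tag stp tagd.
  suff -> : riemann_sum (fun tau => U tau f) s p tag =
      riemann_sum (fun tau => U tau (f - P f)) s p tag + (t - s)%:C%C *: P f.
    by rewrite opprD addrACA subrr addr0; exact: hd.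
  rewrite -(itv_partition_telescope id stp) rmorph_sum scaler_suml -big_split/=.
  by apply: eq_bigr => i _; rewrite -scalerDr linearB/= UPf subrK.
have -> : time_average U t s f = (t - s)^-1%:C%C *: w + P f.
  rewrite /time_average /riemann_integral.
  case: xgetP => [v _ hv|/(_ _ If)//].
  rewrite (riemann_integral_unique st hv If) scalerDr scalerA -rmorphM.
  by rewrite mulVf ?gt_eqF// scale1r.
rewrite addrK hnormZ exprMn wE mulrA -exprMn normfV gtr0_norm//.
by rewrite mulVf ?gt_eqF// expr1n mul1r.
Qed.

End TimeAverages.

(** * Integrals of functions with a power tail *)

Section LayerCake.
Context {R : realType}.

(** Concavity of the logarithm between x and 1. *)
Lemma powR_bernoulli (x g : R) : 0 <= x -> 0 < g <= 1 -> x `^ g <= 1 + g * (x - 1).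
Proof.
rewrite le_eqVlt => /predU1P[<- /andP[g0 g1]|x0 /andP[g0 g1]].
  by rewrite powR0 ?gt_eqF//; lra.
have m0 : 0 < 1 + g * (x - 1).
  have gx0 : 0 < g * x by rewrite mulr_gt0.
  by lra.
have := @concave_ln R (Itv01 (ltW g0) g1) _ _ x0 ltr01.
rewrite !convRE/= /unstable.onem ln1 mulr0 addr0 mulr1 => lnle.
rewrite -ler_ln ?posrE ?powR_gt0// ln_powR (le_trans lnle)//.
by rewrite le_eqVlt; apply/orP; left; apply/eqP; congr ln; ring.
Qed.

(** Comparison of the sum with the integral of x^-b over [0, m]: the Bernoulli
    inequality at x = m / (m + 1) bounds the last term by the increment of the
    primitive x^(1 - b) / (1 - b). *)
Lemma sum_powRN_le (b : R) (m : nat) : 0 <= b < 1 ->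
  \sum_(k < m) k.+1%:R `^ (- b) <= m%:R `^ (1 - b) / (1 - b).
Proof.
move=> /andP[b0 b1]; have g0 : 0 < 1 - b by lra.
elim: m => [|m IH].
  by rewrite big_ord0 divr_ge0 ?powR_ge0 ?(ltW g0).
rewrite big_ord_recr/= (le_trans (lerD IH (lexx _)))//.
set n := m.+1%:R : R; have n0 : 0 < n by rewrite ltr0n.
have bern : (m%:R / n) `^ (1 - b) <= 1 - (1 - b) / n.
  have -> : 1 - (1 - b) / n = 1 + (1 - b) * (m%:R / n - 1).
    rewrite (_ : m%:R = n - 1); last by rewrite /n -natr1 addrK.
    by field; rewrite gt_eqF.
  by apply: powR_bernoulli; [rewrite divr_ge0// ltW|rewrite g0 lerBlDr lerDl].
have -> : n `^ (- b) = n `^ (1 - b) / n.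
  by rewrite powRD ?(gt_eqF n0) ?implybT// powRr1 ?ltW// mulrAC mulfV ?mul1r ?gt_eqF.
have -> : m%:R `^ (1 - b) = n `^ (1 - b) * (m%:R / n) `^ (1 - b).
  by rewrite -powRM ?divr_ge0 ?(ltW n0)// mulrC divfK// gt_eqF.
have p0 : 0 <= n `^ (1 - b) by exact: powR_ge0.
apply: (@le_trans _ _ (n `^ (1 - b) * (1 - (1 - b) / n) / (1 - b) + n `^ (1 - b) / n)).
  by rewrite lerD2r ler_wpM2r ?invr_ge0 ?(ltW g0)// ler_wpM2l.
rewrite le_eqVlt; apply/orP; left; apply/eqP; field.
by rewrite !gt_eqF.
Qed.

(** For y >= 0 the sum counts the integers k >= 0 below y: there are ceil(y) of them. *)
Lemma ceil_count (n : nat) (y : R) : y <= n%:R ->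
  y <= \sum_(k < n) (k%:R < y)%R%:R.
Proof.
elim: n y => [y|n IH y yn]; first by rewrite big_ord0.
have [ny|yn'] := ltP n%:R y; last first.
  by rewrite big_ord_recr/= (le_trans (IH _ yn'))// lerDl ler0n.
rewrite (eq_bigr (fun=> 1)) => [|k _].
  by rewrite sumr_const card_ord.
by rewrite (le_lt_trans _ ny)// ler_nat -ltnS.
Qed.

(** A discrete layer cake formula: with n levels,
    K <= (1 / n) * sum_(k < n) 1_{K > k / n}. The level k = 0 contributes at most
    mu(T) / n, which vanishes as n grows; the others are Riemann sums of
    M u^-b, which stay below M / (1 - b). *)
Lemma Rintegral_le_of_tail d (T : measurableType d)
    (mu : {measure set T -> \bar R}) (K : T -> R) (M b : R) :
    (mu setT < +oo)%E -> measurable_fun setT K ->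
    (forall x, 0 <= K x <= 1) -> 0 <= M -> 0 <= b < 1 ->
    (forall u : R, 0 < u -> (mu [set x | (u < K x)%R] <= (M * u `^ (- b))%:E)%E) ->
  \int[mu]_x K x <= M / (1 - b).
Proof.
move=> muT mK K01 M0 b01 tail.
have finmu A : measurable A -> mu A \is a fin_num.
  move=> mA; rewrite ge0_fin_numE//; apply: le_lt_trans muT.
  by apply: le_measure; rewrite ?inE.
have mtail (u : R) : measurable [set x | u < K x].
  have -> : [set x | u < K x] = setT `&` K @^-1` `]u, +oo[%classic.
    by apply/seteqP; split => x /=; rewrite in_itv/= andbT => // -[].
  exact: mK.
have [b0 b1] := andP b01; have g0 : 0 < 1 - b by lra.
pose tau := fine (mu setT).
suff bound m : \int[mu]_x K x <= tau / m.+1%:R + M / (1 - b).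
  apply/ler_addgt0Pl => e e0; pose m := truncn (tau / e).
  rewrite (le_trans (bound m))// lerD2r ler_pdivrMr ?ltr0n// mulrC -ler_pdivrMr//.
  by rewrite ltW// truncnS_gt.
pose n := m.+1%:R : R; have n0 : 0 < n by rewrite ltr0n.
pose ind (k : 'I_m.+1) := \1_[set x | k%:R / n < K x] : T -> R.
have int_ind k : mu.-integrable setT (EFin \o ind k).
  apply: measurable_bounded_integrable => //; first exact: measurable_indic.
  exists 1; split; [exact: num_real|move=> N N1 x _ /=].
  by rewrite /ind indicE normr_nat (le_trans _ (ltW N1))// lern1 leq_b1.
have int_K : mu.-integrable setT (EFin \o K).
  apply: measurable_bounded_integrable => //.
  exists 1; split; [exact: num_real|move=> N N1 x _ /=].
  have [K0 K1] := andP (K01 x).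
  by rewrite ger0_norm// (le_trans K1)// ltW.
have Kind (x : T) : K x <= n^-1 * \sum_k ind k x.
  have [K0 K1] := andP (K01 x).
  rewrite mulrC ler_pdivlMr//; apply: le_trans (@ceil_count m.+1 _ _) _.
    by rewrite -[leRHS]mul1r ler_wpM2r// ltW.
  apply: ler_sum => k _; rewrite /ind indicE.
  have -> : (x \in [set x | (k%:R / n < K x)%R]) = (k%:R < K x * n).
    by rewrite -ltr_pdivrMr//; apply/idP/idP; rewrite inE.
  exact: lexx.
have Rind k : \int[mu]_x ind k x = fine (mu [set x | (k%:R / n < K x)%R]).
  by rewrite /Rintegral /ind integral_indic// setIT.
have int_sum : mu.-integrable setT (EFin \o (fun x => \sum_k ind k x)).
  have := @integrable_sum _ _ _ mu _ measurableT _ (index_enum 'I_m.+1) xpredT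
    (fun k => EFin \o ind k) (fun k _ => int_ind k).
  by apply: eq_integrable => // x _; rewrite sumEFin.
have Kle : \int[mu]_x K x <= n^-1 * \sum_k \int[mu]_x ind k x.
  rewrite -Rintegral_sum// -RintegralZl//.
  apply: le_Rintegral => //; exact: (integrableZl measurableT n^-1 int_sum).
apply: (le_trans Kle); rewrite mulrC ler_pdivrMr// mulrDl divfK ?gt_eqF//.
rewrite big_ord_recl Rind lerD//.
  by apply: fine_le; rewrite ?finmu//; apply: le_measure; rewrite ?inE.
have level (k : 'I_m) : \int[mu]_x ind (lift ord0 k) x <=
    M * n `^ b * k.+1%:R `^ (- b).
  have kn0 : 0 < k.+1%:R / n by rewrite divr_gt0.
  rewrite Rind (le_trans (fine_le _ _ (tail _ kn0)))//=; first exact: finmu.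
  have nb : n^-1 `^ (- b) = n `^ b.
    by rewrite -powR_inv1 ?ltW// -powRrM mulN1r opprK.
  by rewrite powRM ?invr_ge0 ?(ltW n0)// nb -mulrA [_ * n `^ b]mulrC.
rewrite (le_trans (ler_sum _ (fun k _ => level k)))// -mulr_sumr.
rewrite (le_trans (ler_wpM2l _ (sum_powRN_le m b01)))//.
  by rewrite mulr_ge0// powR_ge0.
have mn : m%:R `^ (1 - b) <= n `^ (1 - b).
  by rewrite ge0_ler_powR ?nnegrE ?(ltW g0)// ler_nat.
rewrite (@le_trans _ _ (M * n `^ b * (n `^ (1 - b) / (1 - b))))//.
  rewrite ler_wpM2l ?mulr_ge0 ?powR_ge0// ler_wpM2r ?invr_ge0 ?(ltW g0)//.
rewrite mulrA -[M * _ * _]mulrA -powRD ?(gt_eqF n0) ?implybT// addrC subrK.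
by rewrite powRr1 ?(ltW n0)// mulrAC.
Qed.

End LayerCake.

(** * The constant rho *)

Section Rho.
Context {R : realType}.
Implicit Types x y c : R.

(** On [0, x] with x <= pi the cosine decreases, so the slope of the sine over [y, x]
    is at most its slope over [0, y]. *)
Lemma sinc_nonincreasing x y : 0 < y -> y <= x -> x <= pi ->
  sin x / x <= sin y / y.
Proof.
move=> y0; rewrite le_eqVlt => /predU1P[->//|yx] xpi.
have x0 : 0 < x by exact: lt_trans yx.
have cs (z : R) : is_derive z 1 sin (cos z) by exact: is_derive_sin.
have cont u v : {within `[u, v], continuous (@sin R)}.
  by apply: continuous_subspaceT => z; exact: continuous_sin.
have [u] := MVT y0 (fun z _ => cs z) (cont _ _).
have [v] := MVT yx (fun z _ => cs z) (cont _ _).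
rewrite !in_itv/= sin0 !subr0 => /andP[yv vx] ev /andP[u0 uy] eu.
have uv : cos v <= cos u.
  have uI : u \in `[0, pi] by rewrite in_itv/=; apply/andP; split; lra.
  have vI : v \in `[0, pi] by rewrite in_itv/=; apply/andP; split; lra.
  by rewrite ltW// ltr_cos//; lra.
rewrite ler_pdivrMr// mulrAC ler_pdivlMr//.
have -> : sin x = sin y + cos v * (x - y) by rewrite -ev addrC subrK.
rewrite eu.
have := ler_wpM2r (_ : 0 <= (x - y) * y) uv.
rewrite mulr_ge0 ?subr_ge0 ?(ltW yx) ?(ltW y0)// => /(_ isT).
by nra.
Qed.

Lemma rho_le (alpha x : R) : 0 < x -> sin x != 0 ->
  rho alpha <= x `^ (2 - alpha) / sin x ^+ 2.
Proof.
move=> x0 sx; apply: ge_inf; last by exists x.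
by exists 0 => _ [y _ <-]; rewrite divr_ge0 ?powR_ge0 ?sqr_ge0.
Qed.

(** Subtracting from x its largest multiple of pi keeps sin^2 x and decreases x, so
    only 0 < x < pi matters for the infimum. *)
Lemma rho_ge (alpha c : R) : alpha < 2 ->
  (forall x, 0 < x < pi -> c <= x `^ (2 - alpha) / sin x ^+ 2) -> c <= rho alpha.
Proof.
move=> alpha2 cle; have a0 : 0 <= 2 - alpha by rewrite subr_ge0 ltW.
apply: lb_le_inf.
  exists ((pi / 2) `^ (2 - alpha) / sin (pi / 2) ^+ 2), (pi / 2) => //.
  by rewrite /= sin_pihalf oner_eq0 divr_gt0 ?pi_gt0.
move=> _ [x [x0 sx] <-].
pose k := truncn (x / pi); pose y := x - pi *+ k.
have k_le : pi *+ k <= x.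
  by rewrite -mulr_natr mulrC -ler_pdivlMr ?pi_gt0// truncn_le divr_ge0 ?pi_ge0 ?ltW.
have xy : x = y + pi *+ k by rewrite /y subrK.
have sxy : sin x ^+ 2 = sin y ^+ 2.
  by rewrite xy (alternatingn (@sinDpi R)) exprMn sqrr_sign mul1r.
have ypi : 0 < y < pi.
  rewrite lt_neqAle subr_ge0 k_le andbT; apply/andP; split.
    by apply: contra_neq sx => y0; apply/eqP; rewrite -sqrf_eq0 sxy -y0 sin0 expr0n.
  rewrite ltrBlDr -mulrS -mulr_natr mulrC -ltr_pdivrMr ?pi_gt0//.
  exact: truncnS_gt.
rewrite (le_trans (cle y ypi))// sxy ler_wpM2r ?invr_ge0 ?sqr_ge0//.
have [y0 _] := andP ypi.
rewrite ge0_ler_powR ?nnegrE ?(ltW y0) ?(ltW x0)// xy lerDl.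
by rewrite mulrn_wge0// pi_ge0.
Qed.

(** The value at x = pi / 2, where the sine is 1. *)
Lemma rho_le_pi (alpha : R) : rho alpha / 2 `^ alpha <= pi `^ (2 - alpha) / 4.
Proof.
have pi2 : 0 < pi / 2 :> R by rewrite divr_gt0 ?pi_gt0.
have s0 : sin (pi / 2) != 0 :> R by rewrite sin_pihalf oner_eq0.
rewrite ler_pdivrMr ?powR_gt0// (le_trans (rho_le alpha pi2 s0))//.
rewrite sin_pihalf expr1n divr1 powRM ?pi_ge0 ?invr_ge0// -mulrA ler_wpM2l ?powR_ge0//.
rewrite -powR_inv1// -powRrM.
have -> : 4^-1 = 2 `^ (- 2) :> R by rewrite (powR_invn 2)// expr2 -natrM.
rewrite -powRD ?pnatr_eq0 ?implybT// le_eqVlt; apply/orP; left; apply/eqP.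
by congr (_ `^ _); ring.
Qed.

End Rho.

(** * Operator norms *)

Section OperatorNorm.
Context {R : realType} {H : hilbertType R} (X : normed_subspace H).
Implicit Types (T : H -> H) (c : R) (f : H).

Lemma ns_norm_gt0 f : ns_carrier X f -> f != 0 -> 0 < ns_norm X f.
Proof.
move=> Xf f0; rewrite lt_def ns_norm_ge0// andbT.
by apply: contra_neq f0; exact: ns_norm_eq0.
Qed.

Lemma opnorm_sqr_le T c : 0 <= c ->
    (forall f, ns_carrier X f -> f != 0 -> hnorm (T f) ^+ 2 <= c * ns_norm X f ^+ 2) ->
  (opnorm X T ^+ 2 <= c%:E)%E.
Proof.
move=> c0 Tc; have op0 : (0 <= opnorm X T)%E by rewrite /opnorm le_max lexx.
have ople : (opnorm X T <= (Num.sqrt c)%:E)%E.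
  rewrite /opnorm ge_max lee_fin sqrtr_ge0/=; apply: ge_ereal_sup => _ [f [Xf f0] <-].
  have nf := ns_norm_gt0 Xf f0.
  rewrite lee_fin ler_pdivrMr// -(ler_pXn2r (n := 2))// ?nnegrE ?hnorm_ge0//.
    by rewrite exprMn sqr_sqrtr// Tc.
  by rewrite mulr_ge0 ?sqrtr_ge0// ltW.
rewrite -(sqr_sqrtr c0) EFin_expe !expe2.
exact: lee_pmul.
Qed.

Lemma opnorm_sqr_ge T c f : (opnorm X T ^+ 2 <= c%:E)%E -> ns_carrier X f -> f != 0 ->
  hnorm (T f) ^+ 2 <= c * ns_norm X f ^+ 2.
Proof.
move=> opc Xf f0; have nf := ns_norm_gt0 Xf f0.
have fop : ((hnorm (T f) / ns_norm X f)%:E <= opnorm X T)%E.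
  by rewrite /opnorm le_max; apply/orP; right; apply: ereal_sup_ubound; exists f.
have q0 : 0 <= hnorm (T f) / ns_norm X f by rewrite divr_ge0 ?hnorm_ge0 ?ltW.
rewrite -ler_pdivrMr ?exprn_gt0// -expr_div_n -lee_fin EFin_expe.
by apply: le_trans opc; rewrite !expe2 lee_pmul.
Qed.

End OperatorNorm.

(** * Fejer integrals against mass near zero *)

Section FejerTails.
Context {R : realType} {H : hilbertType R} (E : resolution H).
Implicit Types (l x u T alpha delta : R) (h : H).

(** Since fejer T l <= (2 / (T l))^2, fejer T l > u
    forces l^2 < (2 / T)^2 / u when l is not 0. *)
Lemma fejer_tail T u : 0 < T -> 0 < u ->
  let delta := 2 / T * u `^ (- 2^-1) in
  [set l | u < fejer T l] `<=` `](- delta), delta]%classic.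
Proof.
move=> T0 u0 delta l /= ul.
have delta0 : 0 < delta by rewrite mulr_gt0 ?divr_gt0 ?powR_gt0.
suff : `|l| < delta.
  by rewrite ltr_norml in_itv/= => /andP[-> /ltW].
have [->|l0] := eqVneq l 0; first by rewrite normr0.
have := lt_le_trans ul (fejer_le T0 l0).
have -> : (2 / (T * l)) ^+ 2 = u * delta ^+ 2 / l ^+ 2.
  have -> : delta ^+ 2 = (2 / T) ^+ 2 / u.
    rewrite /delta exprMn -(powR_mulrn 2 (powR_ge0 u _)) -powRrM mulNr mulVf//.
    by rewrite powR_inv1 ?ltW.
  by field; rewrite l0 !gt_eqF.
have l20 : 0 < l ^+ 2 by rewrite exprn_even_gt0.
rewrite ltr_pdivlMr// ltr_pM2l// => ld.
by rewrite -(ltr_pXn2r (n := 2)) ?nnegrE ?(ltW delta0)// real_normK ?num_real.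
Qed.

(** T = 2 x / delta is chosen so that T l / 2 runs over [-x, x]. *)
Lemma fejer_ge x delta l : 0 < x < pi -> 0 < delta -> `|l| <= delta ->
  (sin x / x) ^+ 2 <= fejer (2 * x / delta) l.
Proof.
move=> /andP[x0 xpi] delta0 ld; rewrite /fejer.
have sx0 : 0 <= sin x / x.
  by rewrite divr_ge0 ?(ltW x0)// sin_ge0_pi// (ltW x0) ltW.
case: eqP => [_|/eqP l0].
  rewrite exprn_ile1// ler_pdivrMr// mul1r (le_trans (ler_norm _))//.
  by rewrite (le_trans (ler_norm_sin x))// ger0_norm// ltW.
have -> : 2 * x / delta * l / 2 = x * l / delta by field; rewrite gt_eqF.
set w := x * l / delta.
have w0 : 0 < `|w|.
  by rewrite normr_gt0 /w !mulf_neq0 ?invr_neq0 ?(lt0r_neq0 x0) ?(lt0r_neq0 delta0).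
have wx : `|w| <= x.
  rewrite !normrM normfV (gtr0_norm x0) (gtr0_norm delta0) ler_pdivrMr//.
  by rewrite ler_wpM2l ?(ltW x0).
have -> : (sin w / w) ^+ 2 = (sin `|w| / `|w|) ^+ 2.
  by have [_|_] := ger0P w; rewrite ?sinN// invrN mulrNN.
rewrite lerXn2r ?nnegrE//.
  rewrite divr_ge0// sin_ge0_pi// (le_trans wx) ?andbT// ltW//.
by apply: sinc_nonincreasing => //; exact: ltW.
Qed.

Lemma fejer_integral_le h alpha (C : R) T : 0 < T -> 0 <= C -> 0 <= alpha < 2 ->
    (forall delta, 0 < delta ->
      (spectral_measure E h `](- delta)%R, delta]%classic
        <= (C * delta `^ alpha)%:E)%E) ->
  \int[spectral_measure E h]_l fejer T l <=
    2 `^ (alpha + 1) / (2 - alpha) * C * T `^ (- alpha).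
Proof.
move=> T0 C0 /andP[alpha0 alpha2] mass.
have -> : 2 `^ (alpha + 1) / (2 - alpha) * C * T `^ (- alpha) =
    C * (2 / T) `^ alpha / (1 - alpha / 2).
  have TV : T^-1 `^ alpha = T `^ (- alpha).
    by rewrite -powR_inv1 ?ltW// -powRrM mulN1r.
  rewrite powRD ?pnatr_eq0 ?implybT// powRr1// powRM ?invr_ge0 ?(ltW T0)// TV.
  field.
  by rewrite !gt_eqF//; lra.
apply: Rintegral_le_of_tail.
- exact: spectral_measure_lty.
- exact: measurable_fejer.
- by move=> l; rewrite fejer_ge0 fejer_le1.
- by rewrite mulr_ge0 ?powR_ge0.
- by apply/andP; split; lra.
move=> u u0; pose delta := 2 / T * u `^ (- 2^-1).
have delta0 : 0 < delta by rewrite mulr_gt0 ?divr_gt0 ?powR_gt0.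
apply: (@le_trans _ _ (spectral_measure E h `](- delta), delta]%classic)).
  apply: le_measure; rewrite ?inE//; last exact: fejer_tail.
  rewrite -[X in measurable X]setTI.
  have -> : [set l | u < fejer T l] = fejer T @^-1` `]u, +oo[%classic.
    by apply/seteqP; split => l /=; rewrite in_itv/= andbT.
  exact: measurable_fejer.
apply: (le_trans (mass _ delta0)).
have T2 : 0 <= 2 / T by rewrite divr_ge0// ltW.
rewrite lee_fin /delta (powRM _ T2 (powR_ge0 _ _)) -powRrM mulrA.
by rewrite le_eqVlt; apply/orP; left; apply/eqP; congr (_ * _ `^ _); ring.
Qed.

Lemma fejer_integral_ge h x delta : 0 < x < pi -> 0 < delta ->
  (sin x / x) ^+ 2 * fine (spectral_measure E h `](- delta)%R, delta]%classic)
  <= \int[spectral_measure E h]_l fejer (2 * x / delta) l.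
Proof.
move=> xpi delta0; have [x0 _] := andP xpi.
set I := `](- delta)%R, delta]%classic; set c := _ ^+ 2.
have T0 : 0 < 2 * x / delta by rewrite divr_gt0 ?mulr_gt0.
have mI : measurable (I : set (measurableTypeR R)) by exact: measurable_itv.
have intI : (spectral_measure E h).-integrable setT (EFin \o (\1_I : R -> R)).
  apply: (@spectral_bounded_integrable _ _ E h _ 1); first exact: measurable_indic.
  by move=> l; rewrite indicE normr_nat lern1 leq_b1.
have <- : \int[spectral_measure E h]_l (\1_I : R -> R) l =
    fine (spectral_measure E h I).
  by rewrite /Rintegral integral_indic// setIT.
rewrite -RintegralZl//; apply: le_Rintegral => //.
- exact: (integrableZl measurableT c intI).
- exact: integrable_fejer.
move=> l _; rewrite indicE; have [lI|_] := boolP (l \in I); last first.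
  by rewrite mulr0 fejer_ge0.
rewrite mulr1 fejer_ge// ler_norml.
by move: lI; rewrite inE /I/= in_itv/= => /andP[/ltW -> ->].
Qed.

End FejerTails.

(** * The equivalence of rates *)

Theorem mainTheorem3 (R : realType) (H : hilbertType R)
    (U : R -> {linear H -> H}) (P : H -> H) (E : resolution H)
    (alpha : R) (X : normed_subspace H)
    (hU : unitary_group U)
    (hP : orthogonal_projection (fixed_space U) P)
    (hE : spectral_resolution E U)
    (halpha : 0 <= alpha < 2) :
  (forall A : R, 0 < A ->
     (forall f : H, ns_carrier X f -> forall delta : R, 0 < delta ->
        (spectral_measure E (f - P f)%R `](- delta)%R, delta]%classic
           <= (A * ns_norm X f ^+ 2 * delta `^ alpha)%:E)%E) ->
     forall t s : R, s < t ->
       (opnorm X (fun f => time_average U t s f - P f)%R ^+ 2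
          <= (2 `^ (alpha + 1) / (2 - alpha) * A * (t - s) `^ (- alpha))%:E)%E)
  /\
  (forall B : R, 0 < B ->
     (forall t s : R, s < t ->
        (opnorm X (fun f => time_average U t s f - P f)%R ^+ 2
           <= (B * (t - s) `^ (- alpha))%:E)%E) ->
     (forall f : H, ns_carrier X f -> forall delta : R, 0 < delta ->
        (spectral_measure E (f - P f)%R `](- delta)%R, delta]%classic
           <= (rho alpha / 2 `^ alpha * B * ns_norm X f ^+ 2
               * delta `^ alpha)%:E)%E)
     /\ rho alpha / 2 `^ alpha * B <= pi `^ (2 - alpha) / 4 * B).
Proof.
have [alpha0 alpha2] := andP halpha.
split=> [A A0 mass t s st|B B0 rate].
  have T0 : 0 < t - s by rewrite subr_gt0.
  apply: opnorm_sqr_le => [|f Xf _].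
    by rewrite !mulr_ge0 ?powR_ge0 ?invr_ge0 ?(ltW A0)// subr_ge0 ltW.
  rewrite (time_averageE hU hE f st hP).
  have C0 : 0 <= A * ns_norm X f ^+ 2 by rewrite mulr_ge0 ?sqr_ge0// ltW.
  apply: (le_trans (fejer_integral_le T0 C0 halpha (mass f Xf))).
  by rewrite le_eqVlt; apply/orP; left; apply/eqP; ring.
split; last by rewrite ler_wpM2r ?rho_le_pi// ltW.
move=> f Xf delta delta0.
set m := spectral_measure _ _ _.
have mfin : m \is a fin_num by exact: spectral_measure_fin_num.
(* the operator norm says nothing about f = 0, for which sigma is the zero measure *)
have [f0|f0] := eqVneq f 0.
  have Pf0 : f - P f = 0.
    have [+ Pf] := hP f; move=> /Pf; rewrite f0 sub0r.
    rewrite linearNl/= => /eqP; rewrite oppr_eq0 dnorm_eq0 => /eqP ->.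
    by rewrite oppr0.
  rewrite /m Pf0 spectral_measure0// lee_fin.
  rewrite !mulr_ge0 ?invr_ge0 ?powR_ge0 ?(ltW B0) ?ns_norm_ge0//.
  by apply: rho_ge => // x _; rewrite divr_ge0 ?powR_ge0 ?sqr_ge0.
(* it remains to show that m / D is a lower bound of the set defining rho alpha *)
pose D := B * ns_norm X f ^+ 2 * delta `^ alpha / 2 `^ alpha.
have nf := ns_norm_gt0 Xf f0.
have D0 : 0 < D by rewrite !mulr_gt0 ?invr_gt0 ?powR_gt0 ?exprn_gt0.
rewrite -(fineK mfin) lee_fin.
have -> : rho alpha / 2 `^ alpha * B * ns_norm X f ^+ 2 * delta `^ alpha =
    rho alpha * D by rewrite /D; ring.
rewrite -ler_pdivrMr//; apply: rho_ge => // x xpi.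
have [x0 xltpi] := andP xpi.
have T0 : 0 < 2 * x / delta by rewrite divr_gt0 ?mulr_gt0.
have := opnorm_sqr_ge (rate (2 * x / delta) 0 T0) Xf f0.
rewrite (time_averageE hU hE f T0 hP) subr0.
move=> /(le_trans (fejer_integral_ge E (f - P f) xpi delta0)).
rewrite -/m.
have s0 : 0 < sin x by exact: sin_gt0_pi.
have -> : B * (2 * x / delta) `^ (- alpha) * ns_norm X f ^+ 2 =
   (sin x / x) ^+ 2 * (x `^ (2 - alpha) / sin x ^+ 2 * D).
  have x2 : x `^ (2 - alpha) = x ^+ 2 * x `^ (- alpha).
    by rewrite powRD ?(gt_eqF x0) ?implybT// powR_mulrn// ltW.
  have dV : (2 * x / delta) `^ (- alpha) = 
    (2 `^ alpha)^-1 * x `^ (- alpha) * delta `^ alpha.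
    have dN : delta^-1 `^ (- alpha) = delta `^ alpha.
      by rewrite -powR_inv1 ?ltW// -powRrM mulN1r opprK.
    by rewrite !powRM ?mulr_ge0 ?invr_ge0 ?(ltW x0) ?(ltW delta0)// dN powRN.
  rewrite x2 dV /D; field.
  by rewrite !gt_eqF ?powR_gt0.
rewrite ler_pM2l; last by rewrite exprn_gt0// divr_gt0.
by rewrite ler_pdivrMr.
Qed.
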